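(* Assume that the Boolean algebra $\mathcal{P}(\mathbb{N})$ is $(\aleph_1,\aleph_0)$-ideal and that $2^{\aleph_1}=\mathfrak{c}=\aleph_2$, where $\mathfrak{c}=2^{\aleph_0}$. If $X$ is a compact separable space of cardinality greater than $\mathfrak{c}$, then $X$ maps continuously onto $[0,1]^{\mathfrak{c}}$.
   Context: Compact spaces are Hausdorff. A subalgebra $A$ of a Boolean algebra $B$ is \emph{$\aleph_0$-ideal} if for each $b\in B\setminus A$ the ideal $\{a\in A: a<b\}$ of $A$ has a countable cofinal subset. A Boolean algebra $B$ is \emph{$(\aleph_1,\aleph_0)$-ideal} if there is a family $\mathcal{A}$ of $\aleph_0$-ideal subalgebras of $B$, each of cardinality $\aleph_1$, such that every subset of $B$ of size $\aleph_1$ is contained in some member of $\mathcal{A}$ and the union of each chain from $\mathcal{A}$ of cofinality $\omega_1$ is again in $\mathcal{A}$. *)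

(* Defs.v *)
From HB Require Import structures.
From mathcomp Require Import all_boot all_order all_algebra.
From mathcomp Require Import all_classical all_reals all_analysis.
Import numFieldNormedType.Exports.

Set Implicit Arguments.
Unset Strict Implicit.
Unset Printing Implicit Defensive.

Local Open Scope classical_set_scope.
Local Open Scope card_scope.
Local Open Scope order_scope.

Definition card_lt (T U : Type) (A : set T) (B : set U) : Prop :=
  A #<= B /\ ~ (B #<= A).

(* Every cardinal below that of B is the cardinal of a subset of B, so the
   minimality clause only needs to range over subsets of B. *)
Definition card_succ (T U : Type) (A : set T) (B : set U) : Prop :=
  card_lt A B /\ forall C : set U, C `<=` B -> card_lt A C -> B #<= C.

(* has_card_aleph n A means that A has cardinality aleph_n.  For n = m + 1 a
   set K of cardinality aleph_m can be sought in the type of A: if A has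
   cardinality aleph_(m+1), then such a K exists already among its subsets. *)
Fixpoint has_card_aleph (n : nat) (T : Type) (A : set T) : Prop :=
  match n with
  | 0%N => A #= [set: nat]
  | m.+1 => exists2 K : set T, has_card_aleph m K & card_succ K A
  end.

Definition cofinal_in (T : Type) (R : T -> T -> Prop) (C D : set T) : Prop :=
  D `<=` C /\ forall c, C c -> exists2 d, D d & R c d.

(* The cofinality of C is the least cardinality of a cofinal subset of C. *)
Definition cofinality_omega1 (T : Type) (R : T -> T -> Prop) (C : set T) :
    Prop :=
  exists D : set T, [/\ cofinal_in R C D, has_card_aleph 1 D
    & forall E : set T, cofinal_in R C E -> D #<= E].

(* Boolean algebras are the complemented distributive lattices with bottom and
   top of the order library. *)
Section BooleanAlgebras.
Context (d : Order.disp_t) (B : ctbDistrLatticeType d).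

Definition subalgebra (A : set B) : Prop :=
  [/\ A \bot, A \top,
      forall x y, A x -> A y -> A (x `&` y),
      forall x y, A x -> A y -> A (x `|` y)
    & forall x, A x -> A (~` x)].

Definition aleph0_ideal (A : set B) : Prop :=
  forall b, ~ A b ->
    exists2 D : set B, countable D &
      cofinal_in (fun x y : B => x <= y) [set a | A a /\ a < b] D.

Definition aleph1_aleph0_ideal : Prop :=
  exists F : set (set B),
    [/\ forall A, F A ->
          [/\ subalgebra A, aleph0_ideal A & has_card_aleph 1 A],
        forall S : set B, has_card_aleph 1 S ->
          exists2 A : set B, F A & (S `<=` A)%classic
      & forall C : set (set B), (C `<=` F)%classic ->
          total_on C subset -> cofinality_omega1 subset C ->
          F (\bigcup_(A in C) A)%classic].

End BooleanAlgebras.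

Definition separable (X : topologicalType) : Prop :=
  exists2 S : set X, countable S & dense S.

(* Main.v *)
Require Import Defs.
From HB Require Import structures.
From mathcomp Require Import all_boot all_order all_algebra.
From mathcomp Require Import all_classical all_reals all_analysis.
From mathcomp Require Import lra ring.
Import numFieldNormedType.Exports.
Import Order.TTheory GRing.Theory Num.Theory.

Set Implicit Arguments.
Unset Strict Implicit.
Unset Printing Implicit Defensive.

Local Open Scope classical_set_scope.
Local Open Scope ring_scope.
Local Open Scope card_scope.

(** A compact Hausdorff space X maps onto the cube as soon as it carries c many
    continuous functions into [0, 1] that take every pattern of values 0 and 1
    simultaneously: since c copies of omega amount to c, group these functions
    in sequences indexed by c, and let each sequence supply the binary digits
    of one coordinate (independent_functions, binary_series, binary_digits).

    Let q : N -> X have dense range, and choose for each x an ultrafilter p x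
    on N that converges to x along q.  Call a pair of subsets of N separated
    if some continuous function on X is 0 on the q-image of the first and 1 on
    that of the second.  By compactness it suffices to find an independent
    family of c separated pairs: any choice of sides from finitely many of
    the pairs has a nonempty intersection.

    Let F be the family of aleph_0-ideal algebras of size aleph_1.  An algebra
    A in F with a subset of A is coded by a subset of aleph_1 x omega, so there
    are at most 2^aleph_1 = c traces p x & A.  As X has more than c points,
    some x is determined by none of its traces: every A in F admits y <> x with
    p y & A = p x & A (exists_undetermined).

    Fix such an x and, for each A in F, a family M(A) of separated pairs that
    is maximal among those independent over the filter base p x & A.  Suppose
    that every M(A) has fewer than c = aleph_2 members.  Then there is a chain
    of algebras A_w in F, w < omega_1, with the members of the pairs of M(A_w)
    occurring in later algebras, and whose union U is in F
    (omega1_closed_union).  Take y <> x with p y & U = p x & U and a separated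
    pair (b0, b1) with b0 in p x and b1 in p y.  The elements of U below the
    complements of b0 and b1 are dominated by countably many of them, and these
    lie in a single A_w.  Thus b0 and b1 can be handled from within A_w, so
    that (b0, b1) can be added to M(A_w) (independent_setU1).  By maximality it
    belongs to M(A_w), whence b0 is in U, so in p y as well as in p x,
    although b1 in p y is disjoint from b0.  Hence some M(A) has size c. *)

(** * Cardinals below the continuum *)

Lemma card_le_injP (T : Type) (U : pointedType) (A : set T) (B : set U) :
  A #<= B <-> exists f : T -> U,
    (forall x, A x -> B (f x)) /\
    (forall x y, A x -> A y -> f x = f y -> x = y).
Proof.
split.
  move=> /pcard_leP[f]; exists f; split => [x Ax|x y Ax Ay].
    exact: (@funS _ _ A B f).
  by apply: (@inj _ _ A f); rewrite inE.
move=> [f [fAB finj]].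
have fA : f @` A `<=` B by move=> _ [x Ax <-]; exact: fAB.
apply: card_le_trans (subset_card_le fA).
suff : f @` A #= A by move/card_eqPle => [].
by apply: inj_card_eq => x y; rewrite !inE => Ax Ay; exact: finj.
Qed.

Lemma card_le_surj (T U : Type) (A : set T) (B : set U) (f : T -> U) :
  B `<=` f @` A -> B #<= A.
Proof.
move=> BfA; exact: card_le_trans (subset_card_le BfA) (card_image_le _ _).
Qed.

(** This form avoids the auxiliary set of size aleph_0, and so transfers along
    bijections between different types. *)
Definition is_aleph1 (T : Type) (K : set T) :=
  ~ countable K /\ forall C, C `<=` K -> ~ countable C -> K #<= C.

Lemma card_le_sub (T : Type) (U : pointedType) (A : set T) (B : set U) :
  A #<= B -> exists2 C : set U, C `<=` B & C #= A.
Proof.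
move=> /card_le_injP[f [fAB finj]]; exists (f @` A).
  by move=> _ [x Ax <-]; exact: fAB.
by apply: inj_card_eq => x y; rewrite !inE => Ax Ay; exact: finj.
Qed.

Lemma uncountable_nat_le (T : Type) (A : set T) :
  ~ countable A -> [set: nat] #<= A.
Proof. by move=> cA; apply/infiniteP => /finite_set_countable. Qed.

Lemma has_card_aleph1P (T : pointedType) (K : set T) :
  has_card_aleph 1 K <-> is_aleph1 K.
Proof.
split => [[K0 /= K0nat [[K0K nK] Kmin]]|[cK Kmin]].
  have nleK0 (C : set T) : ~ countable C -> card_lt K0 C.
    move=> cC; split.
      by rewrite (card_le_eql K0nat); exact: uncountable_nat_le.
    by move=> CK0; apply: cC; apply: card_le_trans CK0 _; move/card_eqPle: K0nat => [].
  split; last by move=> C CK cC; exact: Kmin CK (nleK0 _ cC).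
  move=> cK; apply: nK; apply: card_le_trans cK _.
  by move/card_eqPle: K0nat => [].
have [K0 K0K K0nat] := card_le_sub (uncountable_nat_le cK).
exists K0 => //; split.
  split; first exact: subset_card_le.
  move=> KK0; apply: cK; apply: card_le_trans KK0 _.
  by move/card_eqPle: K0nat => [].
move=> C CK [_ CK0]; apply: Kmin => // cC; apply: CK0.
by rewrite (card_le_eqr K0nat).
Qed.

(** A subset of the target pulls back to a subset of the source of the same
    size, so both clauses are invariant under bijections. *)
Lemma is_aleph1_eq (T U : pointedType) (K : set T) (L : set U) :
  K #= L -> is_aleph1 K -> is_aleph1 L.
Proof.
move=> KL [cK Kmin]; split; first by rewrite -(eq_countable KL).
move=> C CL cC; rewrite -(card_le_eql KL).
have [D DK DC] : exists2 D : set T, D `<=` K & D #= C.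
  by apply: card_le_sub; rewrite (card_le_eqr KL); exact: subset_card_le.
by rewrite -(card_le_eqr DC); apply: Kmin => //; rewrite (eq_countable DC).
Qed.

Lemma is_aleph1_le (T U : pointedType) (K : set T) (L : set U) :
  is_aleph1 K -> L #<= K -> ~ countable L -> K #<= L.
Proof.
move=> [cK Kmin] LK cL; have [C CK CL] := card_le_sub LK.
by rewrite -(card_le_eqr CL); apply: Kmin => //; rewrite (eq_countable CL).
Qed.

Lemma is_aleph1_antisym (T U : pointedType) (K : set T) (S : set U) : is_aleph1 K ->
  K #<= S -> S #<= K -> is_aleph1 S.
Proof. by move=> K1 KS SK; apply: is_aleph1_eq K1; apply/card_eqPle. Qed.

(** Being below the continuum is closed under countable unions, which gives
    all the cardinal arithmetic needed below without comparing arbitrary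
    cardinals. *)
Definition below_continuum (T : Type) (S : set T) := ~ ([set: set nat] #<= S).

Lemma below_continuum_le (T U : Type) (S : set T) (S' : set U) :
  S' #<= S -> below_continuum S -> below_continuum S'.
Proof. by move=> le sS le'; apply: sS; exact: card_le_trans le' le. Qed.

Definition natpair (n k : nat) : nat := choice.pickle (n, k).

Lemma natpair_inj n k n' k' : natpair n k = natpair n' k' -> n = n' /\ k = k'.
Proof. by move=> /(pcan_inj choice.pickleK)[]. Qed.

(** Koenig's argument, that c has uncountable cofinality.  Read a subset of N as
    a sequence of rows; the sets whose image lies in S n do not exhaust the
    possible n-th rows, so some sequence of rows avoids every S n. *)
Lemma below_continuum_bigcup (T : pointedType) (S : nat -> set T) :
  (forall n, below_continuum (S n)) -> below_continuum (\bigcup_n S n).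
Proof.
move=> sS /card_le_injP[f [fS finj]].
pose row n (x : set nat) : set nat := [set k | x (natpair n k)].
have dP n : exists d : set nat, ~ (row n @` (f @^-1` S n)) d.
  apply: contrapT => H; apply: (sS n).
  apply: (@card_le_trans _ _ _ (f @^-1` S n)).
    apply: (@card_le_surj _ _ _ _ (row n)) => d _.
    by apply: contrapT => Hd; apply: H; exists d.
  by apply/card_le_injP; exists f; split => // x y _ _; exact: finj.
have [d dE] := choice dP.
pose x : set nat := [set m | exists n k, m = natpair n k /\ d n k].
have rowx n : row n x = d n.
  apply/seteqP; split => k /=; last by exists n, k.
  by move=> [n' [k' [/natpair_inj[<- <-]]]].
have [n _ Sn] := fS x I.
by apply: (dE n); exists x.
Qed.

Lemma below_continuum_setU (T : pointedType) (S S' : set T) :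
  below_continuum S -> below_continuum S' -> below_continuum (S `|` S').
Proof.
move=> sS sS'.
have /below_continuum_bigcup : forall n,
  below_continuum (if n is 0%N then S else S') by case.
apply: below_continuum_le; apply: subset_card_le => x [Sx|S'x]; first by exists 0%N.
by exists 1%N.
Qed.

Lemma below_continuum_countable_bigcup (J : Type) (T : pointedType)
    (D : set J) (S : J -> set T) :
  countable D -> (forall i, D i -> below_continuum (S i)) ->
  below_continuum (\bigcup_(i in D) S i).
Proof.
move=> /countable_injP[h hinj] sS.
have : forall n, below_continuum (\bigcup_(i in D `&` [set i | h i = n]) S i).
  move=> n; have [[i [Di hi]]|nex] := pselect (exists i, D i /\ h i = n).
    apply: below_continuum_le (sS i Di); apply: subset_card_le => x [j [Dj hj] Sj].
    by rewrite (hinj i j) ?inE // hi.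
  move=> /card_le_injP[f [/(_ setT I)[i [Di hi] _] _]].
  by apply: nex; exists i.
move=> /below_continuum_bigcup; apply: below_continuum_le.
apply: subset_card_le => x [i Di Si].
by exists (h i) => //; exists i.
Qed.

(** Koenig's argument applied to singletons yields Cantor's theorem that N is
    below the continuum. *)
Lemma countable_below_continuum (T : Type) (S : set T) :
  countable S -> below_continuum S.
Proof.
move=> cS; have : below_continuum (\bigcup_(n : nat) [set [set n] : set nat]).
  apply: below_continuum_bigcup => n /card_le_injP[f [fS finj]].
  suff : (set0 : set nat) = setT by move/seteqP => [_ /(_ 0%N I)].
  by apply: finj => //; rewrite (fS set0 I) (fS setT I).
apply: below_continuum_le; apply: card_le_trans cS _.
apply/card_le_injP; exists (fun n => [set n]).
by split => [n _|n m _ _ /seteqP[/(_ n)->]] //; exists n.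
Qed.

(** When c = aleph_2, sets below the continuum have size at most aleph_1: if S
    did not embed in K, then the union of S and K would have size between
    aleph_1 and c without embedding in K, hence size c. *)
Lemma exists_aleph1_bound : has_card_aleph 2 [set: set nat] ->
  exists K : set (set nat), [/\ is_aleph1 K, below_continuum K &
    forall S : set (set nat), below_continuum S -> S #<= K].
Proof.
move=> [K K1 [[_ sK] Kmin]]; exists K.
have sK' : below_continuum K by [].
split => //; first exact/has_card_aleph1P.
move=> S sS; apply: contrapT => SK; apply: (below_continuum_setU sS sK').
apply: Kmin => //; split; first by apply: subset_card_le; right.
by move=> le; apply: SK; apply: card_le_trans le; apply: subset_card_le; left.
Qed.

(** If A had size c, then K would embed in A as an uncountable subset, so that
    c <= |A| <= |K|. *)
Lemma is_aleph1_below_continuum (K A : set (set nat)) :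
    is_aleph1 K -> below_continuum K -> is_aleph1 A ->
    (forall S : set (set nat), below_continuum S -> S #<= K) ->
  A #<= K /\ below_continuum A.
Proof.
move=> [cK Kmin] sK [cA Amin] Kmax.
suff sA : below_continuum A by split => //; exact: Kmax.
move=> leA; have [C CA CK] : exists2 C : set (set nat), C `<=` A & C #= K.
  by apply: card_le_sub; apply: card_le_trans leA; exact: card_leT.
apply: sK; apply: card_le_trans leA _; rewrite -(card_le_eqr CK).
by apply: Amin => //; rewrite (eq_countable CK).
Qed.

(** * A point that algebras of size aleph_1 do not determine *)

Lemma powerset_card_le (T U : pointedType) (A : set T) (B : set U) :
  A #<= B -> [set L | L `<=` A] #<= [set L | L `<=` B].
Proof.
move=> /card_le_injP[f [fAB finj]]; apply/card_le_injP.
exists (fun L => f @` L); split => [L /= LA _ [x Lx <-]|]; first exact/fAB/LA.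
have sub L L' : L `<=` A -> L' `<=` A -> f @` L = f @` L' -> L `<=` L'.
  move=> LA LA' e x Lx; have : (f @` L') (f x) by rewrite -e; exists x.
  by move=> [y Ly /finj] <- //; [exact: LA'|exact: LA].
by move=> L L' LA LA' e; apply/seteqP; split; apply: sub.
Qed.

Lemma set_pairing : exists j : set nat * nat -> set nat, injective j.
Proof.
pose j (u : set nat * nat) : set nat :=
  [set m | (exists2 k, m = natpair 0 k & u.1 k) \/ m = natpair 1 u.2].
exists j => u v e.
suff sub u' v' : j u' = j v' -> u'.1 `<=` v'.1 /\ u'.2 = v'.2.
  have [uv e2] := sub _ _ e; have [vu _] := sub _ _ (esym e).
  rewrite (surjective_pairing u) (surjective_pairing v) e2.
  by rewrite (_ : u.1 = v.1)//; apply/seteqP.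
move=> e'; split => [k uk|].
  have : j v' (natpair 0 k) by rewrite -e'; left; exists k.
  by move=> [[k' /natpair_inj[_ ->]]|/natpair_inj[]].
have : j v' (natpair 1 u'.2) by rewrite -e'; right.
by move=> [[k' /natpair_inj[]]|/natpair_inj[]].
Qed.

(** aleph_1 * aleph_0 = aleph_1, as a countable union of sets below the
    continuum is again below it. *)
Lemma setX_nat_le (K : set (set nat)) :
    below_continuum K -> (forall S : set (set nat), below_continuum S -> S #<= K) ->
  K `*` [set: nat] #<= K.
Proof.
move=> sK Kmax.
have sKN : below_continuum (K `*` [set: nat]).
  suff : below_continuum (\bigcup_n [set u : set nat * nat | K u.1 /\ u.2 = n]).
    apply: below_continuum_le; apply: subset_card_le => -[x n] [/= Kx _].
    by exists n.
  apply: below_continuum_bigcup => n; apply: below_continuum_le sK; apply/card_le_injP.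
  exists fst; split => [[x m] []//|[x m] [y m'] /= [_ /= ->] [_ /= ->] ->//].
have [j jinj] := set_pairing.
have jE : j @` (K `*` [set: nat]) #= K `*` [set: nat].
  by apply: inj_card_eq => x y _ _ /jinj.
rewrite -(card_le_eql jE); apply: Kmax; apply: below_continuum_le sKN.
by rewrite (card_le_eql jE).
Qed.

(** If each point x were determined by its trace on some A x in F, then x could
    be recovered from a subset of K x N: an injection f of A x into K turns
    each a in A x into the column over f a.  That leaves room for at most
    2^|K| points. *)
Lemma exists_undetermined (X : Type) (p : X -> set (set nat))
    (F : set (set (set nat))) (K : set (set nat)) :
    (forall A, F A -> A #<= K) -> K `*` [set: nat] #<= K ->
    [set L | L `<=` K] #<= [set: set nat] -> ~ ([set: X] #<= [set: set nat]) ->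
  exists x, forall A, F A ->
    exists2 y, y <> x & forall a, A a -> (p x a <-> p y a).
Proof.
move=> FK KN PK cX; apply: contrapT => H; apply: cX.
have {}H x : exists A : set (set nat), F A /\
    forall y, (forall a, A a -> (p x a <-> p y a)) -> y = x.
  apply: contrapT => Hx; apply: H; exists x => A FA.
  apply: contrapT => Hy; apply: Hx; exists A; split => // y py.
  by apply: contrapT => yx; apply: Hy; exists y.
have [A AH] := choice H.
have fH x : exists f : set nat -> set nat, (forall a, A x a -> K (f a)) /\
    (forall a b, A x a -> A x b -> f a = f b -> a = b).
  by apply/card_le_injP; apply: FK; have [] := AH x.
have [f fP] := choice fH.
apply: card_le_trans PK; apply: card_le_trans (powerset_card_le KN).
(* In the column over f x a, row 0 records that a is in A x, row 1 that a is
   in p x, and the rows from 2 on list the elements of a. *)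
pose code x : set (set nat * nat) := [set u | exists2 a, A x a &
  u.1 = f x a /\ [\/ u.2 = 0%N, u.2 = 1%N /\ p x a | exists2 n, u.2 = n.+2 & a n]].
apply/card_le_injP; exists code; split.
  by move=> x _ [k n] [a Aa [/= -> _]]; split => //=; apply: (fP x).1.
have key x y a : code x = code y -> A x a -> A y a /\ f x a = f y a.
  move=> e Aa.
  have : code y (f x a, 0%N) by rewrite -e; exists a => //; split => //; apply: Or31.
  move=> [b Ab [/= fab _]].
  suff ab : a = b by split; rewrite ?fab ab.
  apply/seteqP; split => n.
    move=> an; have : code y (f x a, n.+2).
      by rewrite -e; exists a => //; split => //; apply: Or33; exists n.
    move=> [c Ac [/= fac [//|[]//|[m [->] cm]]]].
    by rewrite ((fP y).2 b c) // -fab.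
  move=> bn; have : code x (f x a, n.+2).
    by rewrite e; exists b => //; split => //; apply: Or33; exists n.
  move=> [c Ac [/= fac [//|[]//|[m [->] cm]]]].
  by rewrite ((fP x).2 a c).
have key2 x y a : code x = code y -> A x a -> p x a -> p y a.
  move=> e Aa pa; have [Aya fa] := key x y a e Aa.
  have : code y (f x a, 1%N) by rewrite -e; exists a => //; split => //; apply: Or32.
  move=> [b Ab [/= fab [//|[_ pb]|[m]//]]].
  by rewrite ((fP y).2 a b) // -fa.
move=> x y _ _ e; apply/esym; apply: (AH x).2 => a Aa; split; first exact: key2.
by move=> pya; apply: (key2 y x) => //; have [] := key x y a e Aa.
Qed.

(** * An order of type omega_1 *)

Lemma well_order_lt (T : eqType) : exists lt : T -> T -> Prop,
  well_founded lt /\ (forall x y, [\/ lt x y, x = y | lt y x]).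
Proof.
have [R woR] := wochoice.well_ordering_principle T.
have Rxx x : R x x.
  have [|z [[/eqP zx /(_ x)]]] := woR (pred1 x); first by exists x; rewrite inE.
  by rewrite zx inE eqxx => /(_ isT).
exists (fun x y => ~~ R y x); split.
  move=> x; apply: contrapT => nx.
  have [|z [[Az zmin] _]] := woR (mem [set y | ~ Acc (fun x y => ~~ R y x) y]).
    by exists x; rewrite !inE.
  move: Az; rewrite !inE; apply; constructor => y Rzy; apply: contrapT => ny.
  by move/negP: Rzy; apply; apply: zmin; rewrite !inE.
move=> x y; case Rxy: (R x y); last by apply: Or33.
case Ryx: (R y x); last by apply: Or31.
apply: Or32; have [|z [[Az zmin] zuniq]] := woR (pred2 x y).
  by exists x; rewrite !inE eqxx.
have <- : z = x.
  by apply: zuniq; split; rewrite ?inE ?eqxx // => u; rewrite !inE => /orP[]/eqP->.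
by apply: zuniq; split; rewrite ?inE ?eqxx ?orbT // => u; rewrite !inE => /orP[]/eqP->.
Qed.

(** Cut a well-order of the whole type at the first point that has uncountably
    many predecessors in K, if there is one. *)
Lemma omega1_exists (T : eqType) (K : set T) : ~ countable K ->
  exists (lt : T -> T -> Prop) (W : set T),
  [/\ well_founded lt, forall x y, [\/ lt x y, x = y | lt y x], W `<=` K,
    ~ countable W & forall w, W w -> countable [set v | W v /\ lt v w]].
Proof.
move=> cK; have [lt [lt_wf lt_tot]] := well_order_lt T; exists lt.
have [big|nbig] := pselect (exists x, ~ countable [set v | K v /\ lt v x]); last first.
  exists K; split => // w _; apply: contrapT => H; apply: nbig; by exists w.
have [x0 [x0big x0min]] : exists x, ~ countable [set v | K v /\ lt v x] /\
    forall y, lt y x -> countable [set v | K v /\ lt v y].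
  have [x] := big; elim/(well_founded_ind lt_wf): x => x IH xbig.
  have [[y [yx ybig]]|H] := pselect (exists y, lt y x /\ ~ countable [set v | K v /\ lt v y]).
    exact: IH ybig.
  by exists x; split => // y yx; apply: contrapT => ?; apply: H; exists y.
exists [set v | K v /\ lt v x0]; split => //; first by move=> v [].
move=> w [_ /x0min]; apply: sub_countable; apply: subset_card_le.
by move=> v [[]].
Qed.

(** * Unions of omega_1-chains *)

(** Otherwise W would be a countable union of countable initial segments. *)
Lemma omega1_bounded (T : Type) (lt : T -> T -> Prop) (W W' : set T) :
    (forall x y, [\/ lt x y, x = y | lt y x]) -> ~ countable W ->
    (forall w, W w -> countable [set v | W v /\ lt v w]) ->
    W' `<=` W -> countable W' ->
  exists2 w, W w & forall v, W' v -> lt v w.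
Proof.
move=> lt_tot cW segW W'W cW'; apply: contrapT => H; apply: cW.
suff sub : W `<=` \bigcup_(w in W') ([set w] `|` [set v | W v /\ lt v w]).
  apply: sub_countable (subset_card_le sub) _; apply: bigcup_countable => // w W'w.
  have -> : [set w] `|` [set v | W v /\ lt v w] =
    \bigcup_n (if n is 0%N then [set w] else [set v | W v /\ lt v w]).
    by apply/seteqP; split => [v [?|?]|v [[|n] _ ?]]; [exists 0%N|exists 1%N|left|right].
  by apply: bigcup_countable => // -[|n] _; [exact: countable1|exact/segW/W'W].
move=> w Ww; apply: contrapT => nw; apply: H; exists w => // v W'v.
have [//|vw|wv] := lt_tot v w; exfalso; apply: nw; exists v => //; first by left.
by right.
Qed.

(** A closing-off argument of length omega_1.  Each algebra of the chain is
    chosen in F to contain G of the earlier algebras; countable unions of sets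
    below the continuum are below it, so that a suitable member of F exists.
    Strictness of the chain makes its cofinality omega_1. *)
Lemma omega1_closed_union (F : set (set (set nat)))
    (G : set (set nat) -> set (set nat)) :
    has_card_aleph 2 [set: set nat] ->
    (forall A, F A -> has_card_aleph 1 A) ->
    (forall S : set (set nat), has_card_aleph 1 S -> exists2 A, F A & S `<=` A) ->
    (forall C : set (set (set nat)), C `<=` F -> total_on C subset ->
       cofinality_omega1 subset C -> F (\bigcup_(A in C) A)) ->
    (forall A, F A -> below_continuum (G A)) ->
  exists C : set (set (set nat)), [/\ C `<=` F, F (\bigcup_(A in C) A),
    (forall A, C A -> G A `<=` \bigcup_(B in C) B) &
    forall D, countable D -> D `<=` \bigcup_(A in C) A ->
      exists2 A, C A & D `<=` A].
Proof.
move=> hc F1 Fcov Fchain sG.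
have [K [K1 sK Kmax]] := exists_aleph1_bound hc.
have sF A : F A -> below_continuum A.
  by move=> /F1/has_card_aleph1P A1; have [] := is_aleph1_below_continuum K1 sK A1 Kmax.
have newP (A : set (set nat)) : exists x, below_continuum A -> ~ A x.
  have [sA|nsA] := pselect (below_continuum A); last by exists set0.
  apply: contrapT => H; apply: sA; apply: subset_card_le => x _.
  by apply: contrapT => nx; apply: H; exists x.
have [new {}newP] := choice newP.
have stepP (S : set (set nat)) : exists A, below_continuum S -> F A /\ S `<=` A.
  have [sS|nsS] := pselect (below_continuum S); last by exists set0.
  have [|A FA SA] := Fcov (S `|` K).
    apply/has_card_aleph1P; apply: (is_aleph1_antisym K1).
      by apply: subset_card_le; right.
    by apply: Kmax; exact: below_continuum_setU.
  by exists A => _; split => // x Sx; apply: SA; left.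
have [step {}stepP] := choice stepP.
have [lt [W [lt_wf lt_tot WK cW segW]]] := omega1_exists K1.1.
(* The extra point new A makes the chain strictly increasing. *)
pose G' A := (A `|` G A) `|` [set new A].
have sG' A : F A -> below_continuum (G' A).
  move=> FA; apply: below_continuum_setU; last exact/countable_below_continuum/countable1.
  by apply: below_continuum_setU; [exact: sF|exact: sG].
pose Phi w (rec : forall v, lt v w -> set (set nat)) :=
  step [set x | exists v (vw : lt v w), W v /\ G' (rec v vw) x].
pose A := Fix lt_wf (fun=> set (set nat)) Phi.
have AE w : A w = step (\bigcup_(v in [set v | W v /\ lt v w]) G' (A v)).
  rewrite /A Fix_eq; last first.
    by move=> {}w f g fg; congr (Phi _ _); apply: functional_extensionality_dep => v;
      apply: functional_extensionality_dep => vw; exact: fg.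
  congr step; apply/seteqP; split => x /=.
    by move=> [v [vw [Wv Gv]]]; exists v.
  by move=> [v [Wv vw] Gv]; exists v, vw.
have FA w : W w -> F (A w) /\ forall v, W v -> lt v w -> G' (A v) `<=` A w.
  elim/(well_founded_ind lt_wf): w => w IH Ww.
  have [|Fw subw] := stepP (\bigcup_(v in [set v | W v /\ lt v w]) G' (A v)).
    apply: below_continuum_countable_bigcup (segW w Ww) _ => v [Wv vw].
    by apply: sG'; have [] := IH v vw Wv.
  by rewrite AE; split => // v Wv vw x Gx; apply: subw; exists v.
have Alt v w : W v -> W w -> lt v w -> A v `<=` A w.
  by move=> Wv Ww vw x Ax; apply: (FA w Ww).2 Wv vw _ _; left; left.
have Anew v w : W v -> W w -> lt v w -> ~ (A w `<=` A v).
  move=> Wv Ww vw; move/(_ (new (A v))) => H.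
  apply: (newP (A v)); first by apply: sF; exact: (FA v Wv).1.
  by apply: H; apply: (FA w Ww).2 Wv vw _ _; right.
have Ainj v w : W v -> W w -> A v = A w -> v = w.
  move=> Wv Ww e; have [vw|//|wv] := lt_tot v w; exfalso.
    by apply: (Anew v w) => //; rewrite e.
  by apply: (Anew w v) => //; rewrite e.
pose C := A @` W.
have bounded D : countable D -> D `<=` \bigcup_(B in C) B ->
    exists2 w, W w & D `<=` A w.
  move=> cD DC.
  have /choice[h hP] : forall x, exists w, D x -> W w /\ A w x.
    move=> x; have [Dx|nDx] := pselect (D x); last by exists set0.
    by have [_ [w Ww <-] Ax] := DC x Dx; exists w.
  have [||w Ww wh] := @omega1_bounded _ lt W (h @` D) lt_tot cW segW.
  - by move=> _ [x Dx <-]; exact: (hP x Dx).1.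
  - exact: sub_countable (card_image_le _ _) cD.
  exists w => // x Dx; have [Wh Ah] := hP x Dx.
  by apply: (Alt (h x) w) => //; apply: wh; exists x.
have W1 : is_aleph1 W.
  by apply: (is_aleph1_antisym K1); [exact: K1.2|exact: subset_card_le].
have CW : C #= W by apply: inj_card_eq => v w; rewrite !inE; exact: Ainj.
have C1 : is_aleph1 C by apply: is_aleph1_eq W1; rewrite card_eq_sym.
have unb E : cofinal_in subset C E -> ~ countable E.
  move=> [EC Ecof] cE.
  have [||w Ww wE] := @omega1_bounded _ lt W (W `&` A @^-1` E) lt_tot cW segW.
  - by move=> ? [].
  - apply: sub_countable cE; apply/card_le_injP; exists A; split => [? []//|].
    by move=> v w [Wv _] [Ww _]; exact: Ainj.
  have [|B EB wB] := Ecof (A w); first by exists w.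
  have [v Wv vB] := EC B EB; rewrite -vB in EB wB; apply: (Anew v w) => //; exact: wE.
have CF : C `<=` F by move=> _ [w Ww <-]; exact: (FA w Ww).1.
exists C; split => //.
- apply: Fchain => //.
    move=> _ _ [v Wv <-] [w Ww <-].
    have [vw|->|wv] := lt_tot v w; [left|by left|right]; exact: Alt.
  exists C; split; last first.
  - move=> E Ecof; apply: C1.2 (unb _ Ecof); exact: Ecof.1.
  - exact/has_card_aleph1P.
  - by split => // c Cc; exists c.
- move=> _ [v Wv <-].
  have [||w Ww vw] := @omega1_bounded _ lt W [set v] lt_tot cW segW.
  - by move=> _ ->.
  - exact: countable1.
  move=> x Gx; exists (A w); first by exists w.
  by apply: (FA w Ww).2 Wv _ _ _; [exact: vw|left; right].
- by move=> D cD /(bounded D cD)[w Ww Dw]; exists (A w) => //; exists w.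
Qed.

(** * Large independent families *)

Definition side (e : bool) (m : set nat * set nat) : set nat :=
  if e then m.2 else m.1.

(** The choices are given by a function e on all pairs, so that repetitions in
    l are harmless and no consistency condition is needed. *)
Definition meet_sides (e : set nat * set nat -> bool)
    (l : seq (set nat * set nat)) : set nat :=
  foldr (fun m acc => side (e m) m `&` acc) setT l.

(** H plays the role of a filter base, here the trace of an ultrafilter on an
    algebra. *)
Definition independent (H : set (set nat)) (M : set (set nat * set nat)) :=
  forall e l, (forall m, m \in l -> M m) ->
  forall a, H a -> (a `&` meet_sides e l) !=set0.

Lemma meetP e l n : meet_sides e l n <-> forall m, m \in l -> side (e m) m n.
Proof.
elim: l => [|m l IH]; first by split.
split=> [[sm /IH ml] m'|H]; first by rewrite inE => /orP[/eqP->//|/ml].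
split; first by apply: H; rewrite inE eqxx.
by apply/IH => m' m'l; apply: H; rewrite inE m'l orbT.
Qed.

(** Independence has finite character, so Zorn's lemma applies; the hypothesis on
    H is independence of the empty family. *)
Lemma maximal_independent (H : set (set nat)) (Sep : set (set nat * set nat)) :
    (forall a, H a -> a !=set0) ->
  exists M, [/\ M `<=` Sep, independent H M &
    forall m, Sep m -> independent H (M `|` [set m]) -> M m].
Proof.
move=> H0.
have [F FP Ftot|M [[MS Mind] Mmax]] :=
  @Zorn_bigcup _ [set M | M `<=` Sep /\ independent H M].
  split; first by move=> m [M /FP[MS _] /MS].
  move=> e l lF a Ha.
  have [->|[M FM lM]] : l = [::] \/ exists2 M, F M & forall m, m \in l -> M m.
  - elim: l lF => [|m l IH] lF; first by left.
    right; have [M FM Mm] : (\bigcup_(M in F) M) m by apply: lF; rewrite inE eqxx.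
    have [m' m'l||[M' FM' lM']] := IH.
    + by apply: lF; rewrite inE m'l orbT.
    + by move=> ->; exists M => // m'; rewrite inE => /eqP->.
    have [MM'|M'M] := Ftot _ _ FM FM'.
      by exists M' => // m'; rewrite inE => /orP[/eqP->|/lM'//]; exact: MM'.
    by exists M => // m'; rewrite inE => /orP[/eqP->//|/lM' /M'M].
  - by rewrite /= setIT; exact: H0.
  - by have [_ Mind] := FP M FM; exact: Mind.
exists M; split => // m Sm Mm; apply: contrapT => nMm.
apply: (Mmax (M `|` [set m])).
  by split; [left|move=> /(_ m (or_intror erefl))].
by split => // m' [/MS//|->].
Qed.

(** The heart of the proof.  Suppose that c, the meet of some a in A & u with
    sides of pairs of M, misses a side b of m.  As c is in B, the approximation
    hypothesis gives c' in A with c <= c' <= ~ b.  Now u and v agree on A and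
    b lies in one of them, so c' is not in u.  Hence a & ~ c' is still in
    A & u, and independence of M makes it meet the same sides; but their
    common points lie in c and outside c'. *)
Lemma independent_setU1 (A B : set (set nat)) (u v : set (set nat))
    (M : set (set nat * set nat)) (m : set nat * set nat) :
    UltraFilter u -> UltraFilter v ->
    (forall a b, B a -> B b -> B (a `&` b)) -> B setT ->
    (forall a, A a -> A (~` a)) -> (forall a b, A a -> A b -> A (a `&` b)) ->
    A `<=` B ->
    (forall b, B b -> (u b <-> v b)) ->
    (forall m', M m' -> B m'.1 /\ B m'.2) ->
    u m.1 -> v m.2 ->
    (forall e c, B c -> c `<=` ~` side e m ->
       exists2 c', A c' & c `<=` c' /\ c' `<=` ~` side e m) ->
    independent (A `&` u) M ->
  independent (A `&` u) (M `|` [set m]).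
Proof.
move=> uU vU BI BT AC AI AB uv MB um vm approx Mind e l lM a [Aa ua].
pose l' := [seq m' <- l | m' != m].
have l'M m' : m' \in l' -> M m'.
  by rewrite mem_filter => /andP[/eqP m'm /lM[]].
have Bl' : B (a `&` meet_sides e l').
  apply: (BI); first exact: AB.
  elim: l' l'M => [//|m' k IH kM] /=; apply: (BI); last first.
    by apply: IH => m'' ?; apply: kM; rewrite inE; apply/orP; right.
  have [] := MB m'; first by apply: kM; rewrite inE eqxx.
  by rewrite /side; case: (e m').
have [[n [[an l'n] sn]]|H] := pselect ((a `&` meet_sides e l') `&` side (e m) m !=set0).
  exists n; split => //; apply/meetP => m' m'l.
  have [->//|m'm] := eqVneq m' m.
  by move/meetP : l'n; apply; rewrite mem_filter m'm.
have [|c' Ac' [cc' c's]] := approx (e m) _ Bl'.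
  by move=> n cn sn; apply: H; exists n.
(* u contains the first side of m and v the second, while u and v agree
   on c'. *)
have nuc' : u (~` c').
  have [uc'|//] := in_ultra_setVsetC c' uU; exfalso.
  move: c's; rewrite /side; case: (e m) => c's.
    have vc' : v c' by apply/uv => //; exact: AB.
    by have [n [/c's]] := @filter_ex _ v _ _ (filterI vc' vm).
  by have [n [/c's]] := @filter_ex _ u _ _ (filterI uc' um).
have [|n [[an nc'] l'n]] := Mind e l' l'M (a `&` ~` c').
  by split; [apply: AI => //; exact: AC|exact: filterI].
by exfalso; apply: nc'; apply: cc'.
Qed.

(** For b in A the singleton of b serves; for b outside A, strict and weak
    inclusion in b agree on A. *)
Lemma aleph0_ideal_countable_approx (A : set (set nat)) :
  @subalgebra _ (set nat : ctbDistrLatticeType set_display) A ->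
  @aleph0_ideal _ (set nat : ctbDistrLatticeType set_display) A ->
  forall b : set nat, exists D : set (set nat), [/\ countable D, D `<=` A &
    forall c, A c -> c `<=` b -> exists2 d, D d & c `<=` d /\ d `<=` b].
Proof.
move=> _ Aid b; have [Ab|nAb] := pselect (A b).
  by exists [set b]; split;
    [exact: countable1|by move=> _ ->|by move=> c Ac cb; exists b; split].
have [D cD [DA Dcof]] := Aid b nAb; exists D; split => //; first by move=> d /DA[].
move=> c Ac cb; have [|d Dd cd] := Dcof c.
  split => //; rewrite properEset; split => // bc.
  by apply: nAb; rewrite (_ : b = c)//; apply/seteqP.
exists d => //; split; first by move: cd; rewrite subsetEset.
by have [_] := DA d Dd; rewrite properEset => -[].
Qed.

(** If every maximal family were below the continuum, then the pair that splits
    x from a point y with the same trace on the closed-off union U could be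
    added to one of them, and hence would lie in U. *)
Lemma large_independent_family (X : Type) (p : X -> set (set nat))
    (Sep : set (set nat * set nat)) :
    aleph1_aleph0_ideal (set nat : ctbDistrLatticeType set_display) ->
    (exists2 K : set (set nat),
       has_card_aleph 1 K & [set L | L `<=` K] #= [set: set nat]) ->
    has_card_aleph 2 [set: set nat] ->
    ~ ([set: X] #<= [set: set nat]) ->
    (forall x, UltraFilter (p x)) ->
    (forall m, Sep m -> m.1 `&` m.2 = set0) ->
    (forall x y, y <> x -> exists m, [/\ Sep m, p x m.1 & p y m.2]) ->
  exists M, [/\ M `<=` Sep, [set: set nat] #<= M & independent [set setT] M].
Proof.
move=> [F [FP Fcov Fchain]] [K' K'1 PK'] hc cX pU Sep0 Sepp.
have [K [K1 sK Kmax]] := exists_aleph1_bound hc.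
have F1 A : F A -> has_card_aleph 1 A by move=> /FP[].
have FK A : F A -> A #<= K.
  by move=> /F1/has_card_aleph1P A1; have [] := is_aleph1_below_continuum K1 sK A1 Kmax.
have KK' : K #<= K'.
  move/has_card_aleph1P : K'1 => K'1; apply: is_aleph1_le => //; last exact: K'1.1.
  by have [] := is_aleph1_below_continuum K1 sK K'1 Kmax.
have PK : [set L | L `<=` K] #<= [set: set nat].
  by rewrite -(card_le_eqr PK'); exact: powerset_card_le.
have [x xP] := exists_undetermined p FK (setX_nat_le sK Kmax) PK cX.
have /choice[Mx MxP] : forall A, exists M, [/\ M `<=` Sep, independent (A `&` p x) M &
    forall m, Sep m -> independent (A `&` p x) (M `|` [set m]) -> M m].
  by move=> A; apply: maximal_independent => a [_ pa]; exact: filter_ex pa.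
have [[A [FA bigA]]|nbig] := pselect (exists A, F A /\ ~ below_continuum (Mx A)).
  have [MS Mind _] := MxP A; exists (Mx A); split => //.
    by apply: contrapT => ?; exact: bigA.
  move=> e l lM _ ->; apply: Mind => //; split; last exact: filterT.
  by have [[_ AT _ _ _] _ _] := FP A FA.
exfalso.
pose G A := fst @` Mx A `|` snd @` Mx A.
have sG A : F A -> below_continuum (G A).
  move=> FA; have sM : below_continuum (Mx A).
    by apply: contrapT => nsM; apply: nbig; exists A.
  by apply: below_continuum_setU; apply: below_continuum_le sM; exact: card_image_le.
have [C [CF FU GC CD]] := omega1_closed_union hc F1 Fcov Fchain sG.
set U := \bigcup_(A in C) A in FU GC CD.
have [y yx xy] := xP U FU.
have [m [Sm pxm pym]] := Sepp x y yx.
have [Usub Uid _] := FP U FU.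
have [D0 [cD0 D0U D0P]] := aleph0_ideal_countable_approx Usub Uid (~` m.1).
have [D1 [cD1 D1U D1P]] := aleph0_ideal_countable_approx Usub Uid (~` m.2).
(* The approximations from below to both complements fit in one member of
   the chain. *)
have [||A CA DA] := CD (\bigcup_(b in [set: bool]) (if b then D1 else D0)).
- by apply: bigcup_countable => // -[].
- by move=> d [[] _ ?]; [exact: D1U|exact: D0U].
have [[_ _ AI _ AC] _ _] := FP A (CF A CA).
have [[_ UT UI _ _] _ _] := FP U FU.
have AU : A `<=` U by move=> a Aa; exists A.
have [_ Mind Mmax] := MxP A.
have MU m' : Mx A m' -> U m'.1 /\ U m'.2.
  by move=> Mm'; split; apply: (GC A CA); [left|right]; exists m'.
have /(MU m)[Um1 _] : Mx A m.
  apply: Mmax => //; apply: (independent_setU1 (B := U) (v := p y)) => //.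
  move=> e c Uc cs; case: e cs => cs.
    by have [d Dd [cd ds]] := D1P c Uc cs; exists d => //; apply: DA; exists true.
  by have [d Dd [cd ds]] := D0P c Uc cs; exists d => //; apply: DA; exists false.
have pym1 : p y m.1 by apply/(xy _ Um1).
by have [n] := filter_ex (filterI pym1 pym); rewrite Sep0.
Qed.

(** * Traces on a dense sequence *)

Lemma separable_dense_seq (X : topologicalType) (x0 : X) : separable X ->
  exists q : nat -> X, forall O : set X, open O -> O !=set0 -> exists n, O (q n).
Proof.
move=> [S /countable_injP[f finj] dS].
have /choice[q qP] : forall n, exists x, forall y, S y -> f y = n -> y = x.
  move=> n; have [[x [Sx fx]]|H] := pselect (exists x, S x /\ f x = n).
    by exists x => y Sy fy; apply: finj; rewrite ?inE// fx.
  by exists x0 => y Sy fy; exfalso; apply: H; exists y.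
exists q => O oO O0; have [y [Oy Sy]] := dS O O0 oO.
by exists (f y); rewrite -(qP (f y) y).
Qed.

Section Separation.
Context (R : realType) (X : topologicalType) (q : nat -> X).

Definition separated_traces : set (set nat * set nat) := [set m | exists h : X -> R,
  [/\ continuous h, (forall x, 0 <= h x <= 1),
    (forall n, m.1 n -> h (q n) = 0) & (forall n, m.2 n -> h (q n) = 1)]].

Lemma normal_function (A B : set X) : normal_space X ->
    closed A -> closed B -> A `&` B = set0 ->
  exists h : X -> R, [/\ continuous h, (forall x, 0 <= h x <= 1),
    (forall x, A x -> h x = 0) & (forall x, B x -> h x = 1)].
Proof.
move=> nX cA cB AB.
have /(uniform_separatorP (R := R))[h [hc h01 hA hB]] :=
  (normal_separatorP (R := R)).1 nX A B cA cB AB.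
exists h; split => //.
- by move=> x; have := h01 (h x); rewrite /= in_itv /=; apply; exists x.
- by move=> x Ax; apply: hA; exists x.
- by move=> x Bx; apply: hB; exists x.
Qed.

(** A Urysohn function g that separates x from y is cut at 1/3 and 2/3, which
    yields disjoint closed neighbourhoods; they are separated by a second
    Urysohn function that is constant on each. *)
Lemma separated_traces_exist (p : X -> set (set nat)) :
    hausdorff_space X -> normal_space X ->
    (forall x U, nbhs x U -> p x (q @^-1` U)) ->
  forall x y, y <> x -> exists m, [/\ separated_traces m, p x m.1 & p y m.2].
Proof.
move=> hX nX pU x y yx.
have cl1 (z : X) : closed [set z] by apply: accessible_closed_set1; exact: hausdorff_accessible.
have [|g [gc g01 gx gy]] := normal_function nX (cl1 x) (cl1 y).
  by apply/seteqP; split => // z [->] /esym.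
pose A := g @^-1` [set t | t <= 3^-1]; pose B := g @^-1` [set t | 2 * 3^-1 <= t].
have cA : closed A by apply: closed_comp => [z _|]; [exact: gc|exact: closed_le].
have cB : closed B by apply: closed_comp => [z _|]; [exact: gc|exact: closed_ge].
have [|h [hc h01 hA hB]] := normal_function nX cA cB.
  by apply/seteqP; split => // z []; rewrite /A /B /= => gA gB;
  have := le_trans gB gA; clear; rewrite /= => ?; lra.
exists (q @^-1` A, q @^-1` B); split => /=.
- by exists h; split => // n ?; [exact: hA|exact: hB].
- apply: pU; have : nbhs (g x) [set t : R | t < 3^-1].
    by apply: open_nbhs_nbhs; split; [exact: open_lt|rewrite /= (gx x)// invr_gt0].
  by move=> /gc; apply: filterS => z /ltW.
- apply: pU; have : nbhs (g y) [set t : R | 2 * 3^-1 < t].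
    by apply: open_nbhs_nbhs; split; [exact: open_gt|rewrite /= (gy y)//; lra].
  by move=> /gc; apply: filterS => z /ltW.
Qed.

Lemma trace_ultrafilters :
    (forall O : set X, open O -> O !=set0 -> exists n, O (q n)) ->
  exists p : X -> set (set nat), (forall x, UltraFilter (p x)) /\
    (forall x U, nbhs x U -> p x (q @^-1` U)).
Proof.
move=> qd.
have exG (x : X) : exists G : set_system nat, UltraFilter G /\
    (forall U, nbhs x U -> G (q @^-1` U)).
  have PF : ProperFilter (filter_from (nbhs x) (fun U => q @^-1` U)).
    apply: filter_from_proper.
      apply: filter_from_filter; first by exists setT; exact: filterT.
      by move=> U V xU xV; exists (U `&` V) => //; exact: filterI.
    move=> U xU; have [n Un] := qd U^° (open_interior U) (ex_intro _ x xU).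
    by exists n; exact: interior_subset Un.
  have [G [GU sG]] := ultraFilterLemma PF.
  by exists G; split => // U xU; apply: sG; exists U.
by have [p pP] := choice exG; exists p; split => x; have [] := pP x.
Qed.

(** The images under q of the finite meets form a filter base; at a cluster point
    each h m takes the value that it has on the chosen side of m. *)
Lemma independent_point (M : set (set nat * set nat))
    (h : set nat * set nat -> X -> R) :
    compact [set: X] -> independent [set setT] M ->
    (forall m, M m -> [/\ continuous (h m),
      (forall n, m.1 n -> h m (q n) = 0) & (forall n, m.2 n -> h m (q n) = 1)]) ->
  forall e : set nat * set nat -> bool, exists z, forall m, M m -> h m z = (e m)%:R.
Proof.
move=> cX Mind hP e.
pose D := [set l : seq (set nat * set nat) | forall m, m \in l -> M m].
have PF : ProperFilter (filter_from D (fun l => q @` meet_sides e l)).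
  apply: filter_from_proper.
    apply: filter_from_filter; first by exists [::].
    move=> l k Dl Dk; exists (l ++ k).
      by move=> m; rewrite mem_cat => /orP[/Dl|/Dk].
    move=> _ [n /meetP nlk <-]; split; exists n => //; apply/meetP => m ml;
      by apply: nlk; rewrite mem_cat ml ?orbT.
  move=> l Dl; have [n [_ nl]] := Mind e l Dl setT erefl.
  by exists (q n); exists n.
have [|z [_ clz]] := cX _ PF; first exact: filterT.
exists z => m Mm; have [hc h0 h1] := hP m Mm.
have cl : closed (h m @^-1` [set (e m)%:R]).
  by apply: closed_comp => [x _|]; [exact: hc|exact: closed_eq].
apply: cl => U zU; apply: clz _ zU; exists [:: m].
  by move=> m'; rewrite inE => /eqP->.
move=> _ [n [/= sn _] <-]; move: sn; rewrite /side; case: (e m); first exact: h1.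
exact: h0.
Qed.

End Separation.

(** * Binary expansions *)

Definition binary_sum (R : realType) (a : nat -> R) (N : nat) : R :=
  \sum_(0 <= k < N) a k * 2^-1 ^+ k.+1.

(** Greedy expansion: r n is the remainder after n digits, rescaled to
    [0, 1]. *)
Lemma binary_digits (R : realType) (y : R) : 0 <= y <= 1 ->
  exists d : nat -> bool, forall N,
    binary_sum (fun k => (d k)%:R) N <= y <= binary_sum (fun k => (d k)%:R) N + 2^-1 ^+ N.
Proof.
move=> y01.
pose r := fix r n : R := if n is n'.+1 then 2 * r n' - (2^-1 <= r n')%R%:R else y.
have r01 n : 0 <= r n <= 1.
  elim: n => [//|n IH] /=; case: (lerP 2^-1 (r n)) => /=; lra.
pose d n := 2^-1 <= r n.
have key N : y = binary_sum (fun k => (d k)%:R) N + 2^-1 ^+ N * r N.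
  elim: N => [|N IH]; first by rewrite /binary_sum big_nil /= expr0 add0r mul1r.
  rewrite /binary_sum big_nat_recr //= -/(binary_sum _ N) {1}IH -/(d N) exprSr.
  by field.
exists d => N; have e := key N; have p2 : 0 <= (2^-1 : R) ^+ N by rewrite exprn_ge0// invr_ge0.
have := mulr_ge0 p2 (andP (r01 N)).1; have := ler_wpM2l p2 (andP (r01 N)).2.
rewrite mulr1 => ? ?; apply/andP; split; lra.
Qed.

Lemma expr_half_lt (R : realType) (e : R) : 0 < e -> exists N, (2^-1 : R) ^+ N < e.
Proof.
move=> e0; have := @cvg_expr R 2^-1.
have h1 : `|2^-1 : R| < 1 by rewrite ger0_norm; lra.
move=> /(_ h1)/cvgrPdist_lt/(_ e e0)[N _ /(_ N (leqnn N))] /=.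
by rewrite sub0r normrN ger0_norm ?exprn_ge0 ?invr_ge0// => ?; exists N.
Qed.

Lemma binary_sum_le (R : realType) (a : nat -> R) (s t : R) :
    (forall N, binary_sum a N <= s <= binary_sum a N + 2^-1 ^+ N) ->
    (forall N, binary_sum a N <= t <= binary_sum a N + 2^-1 ^+ N) ->
  s <= t.
Proof.
move=> sP tP; rewrite leNgt; apply/negP => ts.
have [|N] := @expr_half_lt R (s - t); first by rewrite subr_gt0.
by have := sP N; have := tP N; lra.
Qed.

Lemma continuous_binary_sum (R : realType) (X : topologicalType) (h : nat -> X -> R) N :
  (forall k, continuous (h k)) -> continuous (fun x => binary_sum (h^~ x) N).
Proof.
move=> hc x; elim: N => [|N IH].
  by rewrite /binary_sum; under eq_fun do rewrite big_nil; exact: cvg_cst.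
rewrite /binary_sum; under eq_fun do rewrite big_nat_recr //=.
by apply: cvgD; [exact: IH|apply: cvgMl; exact: hc].
Qed.

(** The sum of the binary series, taken as the supremum of its partial sums; the
    uniform error bound 2^-N makes it continuous. *)
Lemma binary_series (R : realType) (X : topologicalType) (h : nat -> X -> R) :
    (forall k, continuous (h k)) -> (forall k x, 0 <= h k x <= 1) ->
  exists f : X -> R, continuous f /\
    (forall x N, binary_sum (h^~ x) N <= f x <= binary_sum (h^~ x) N + 2^-1 ^+ N).
Proof.
move=> hc h01.
pose S N x := binary_sum (h^~ x) N.
have p2 N : 0 < (2^-1 : R) ^+ N by rewrite exprn_gt0// invr_gt0.
have step N x : S N x <= S N.+1 x /\ S N.+1 x + 2^-1 ^+ N.+1 <= S N x + 2^-1 ^+ N.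
  rewrite /S /binary_sum big_nat_recr //=; set s := \sum_(_ <= _ < _) _.
  rewrite exprS; set t := _ ^+ N; have t0 : 0 < t := p2 N.
  have /andP[h0 h1] := h01 N x; split; nra.
have Sle x N M : (N <= M)%N -> S N x <= S M x.
  by move=> /subnK<-; elim: (M - N)%N => [|k IH]//; apply: le_trans IH (step _ x).1.
have Tle x N M : (N <= M)%N -> S M x + 2^-1 ^+ M <= S N x + 2^-1 ^+ N.
  by move=> /subnK<-; elim: (M - N)%N => [|k IH]//; apply: le_trans (step _ x).2 IH.
have ST x N M : S M x <= S N x + 2^-1 ^+ N.
  have [NM|MN] := leqP N M.
    by apply: le_trans (Tle x _ _ NM); rewrite lerDl ltW.
  by apply: le_trans (Sle x _ _ (ltnW MN)) _; rewrite lerDl ltW.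
pose f x := sup (range (S^~ x)).
have fP x N : S N x <= f x <= S N x + 2^-1 ^+ N.
  apply/andP; split.
    apply: ub_le_sup; last by exists N.
    by exists (S 0%N x + 2^-1 ^+ 0) => _ [M _ <-].
  apply: ge_sup; first by exists (S 0%N x), 0%N.
  by move=> _ [M _ <-].
exists f; split => // x.
apply/cvgrPdist_lt => e e0.
have e3 : 0 < e / 3 by rewrite divr_gt0.
have [N Ne] := expr_half_lt e3.
have := @continuous_binary_sum _ _ h N hc x => /cvgrPdist_lt/(_ _ e3).
apply: filterS => y /=; rewrite -/(S N x) -/(S N y) !ltr_norml.
by have := fP x N; have := fP y N; lra.
Qed.

(** * The map onto the cube *)

Lemma continuous_ptws (R : realType) (I : Type) (A : set R) (X : topologicalType)
    (f : X -> {ptws I -> set_type A}) :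
  (forall i, continuous (fun x => set_val (f x i) : R)) -> continuous f.
Proof.
move=> H x; apply/cvg_sup => i.
apply: (@continuous_comp_initial _ _ _ (fun g : I -> set_type A => g i) f).
by apply: (@continuous_comp_initial _ _ _ (@set_val _ A) _ (H i)).
Qed.

(** The functions separating c many independent pairs, reindexed by sets and
    naturals. *)
Lemma independent_functions (R : realType)
    (hideal : aleph1_aleph0_ideal (set nat : ctbDistrLatticeType set_display))
    (hpow : exists2 K : set (set nat),
       has_card_aleph 1 K & [set L | L `<=` K] #= [set: set nat])
    (hc : has_card_aleph 2 [set: set nat])
    (X : topologicalType)
    (hcompact : compact [set: X]) (hhausdorff : hausdorff_space X)
    (hseparable : separable X)
    (hcard : card_lt [set: set nat] [set: X]) :
  exists h : set nat -> nat -> X -> R,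
    [/\ forall i n, continuous (h i n), forall i n x, 0 <= h i n x <= 1 &
      forall d : set nat -> nat -> bool, exists z, forall i n, h i n z = (d i n)%:R].
Proof.
have [_ cX] := hcard.
have [x0] : inhabited X.
  apply: contrapT => nX; apply: cX; apply/card_le_injP; exists (fun=> set0).
  by split => // x; exfalso; apply: nX; exists.
have [q qd] := separable_dense_seq x0 hseparable.
have [p [pU pnbhs]] := trace_ultrafilters qd.
have nX := compact_normal hhausdorff hcompact.
have [M [MS bigM Mind]] : exists M, [/\ M `<=` separated_traces R q,
    [set: set nat] #<= M & independent [set setT] M].
  apply: (large_independent_family (p := p)) => //; last exact: separated_traces_exist.
  move=> m [h [_ _ h0 h1]]; apply/seteqP; split => // n [/h0 h0n /h1].
  by rewrite h0n => /esym/eqP; rewrite oner_eq0.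
have /choice[h hP] : forall m, exists h : X -> R, M m ->
    [/\ continuous h, (forall x, 0 <= h x <= 1),
    (forall n, m.1 n -> h (q n) = 0) & (forall n, m.2 n -> h (q n) = 1)].
  move=> m; have [/MS[h ?]|nMm] := pselect (M m); first by exists h.
  by exists (fun=> 0).
have [j jinj] := set_pairing.
have /card_le_injP[g [gM ginj]] := bigM.
have gj i n : M (g (j (i, n))) by exact: gM.
exists (fun i n => h (g (j (i, n)))); split.
- by move=> i n; have [] := hP _ (gj i n).
- by move=> i n; have [] := hP _ (gj i n).
move=> d.
(* The pattern d, transported to pairs along the injection (i, n) |-> m. *)
pose e m := `[< exists i n, m = g (j (i, n)) /\ d i n >].
have [|z zP] := @independent_point R X q M h hcompact Mind _ e.
- by move=> m /hP[].
exists z => i n; rewrite zP //; congr (_%:R); congr nat_of_bool.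
apply/asboolP/idP => [[i' [n' []]]|din]; last by exists i, n.
by move=> /(ginj _ _ I I)/jinj[-> ->].
Qed.

Unset Implicit Arguments.

Theorem theorem3p3 (R : realType)
    (hideal : aleph1_aleph0_ideal (set nat : ctbDistrLatticeType set_display))
    (hpow : exists2 K : set (set nat),
       has_card_aleph 1 K & [set L | L `<=` K] #= [set: set nat])
    (hc : has_card_aleph 2 [set: set nat])
    (X : topologicalType)
    (hcompact : compact [set: X]) (hhausdorff : hausdorff_space X)
    (hseparable : separable X)
    (hcard : card_lt [set: set nat] [set: X]) :
  exists f : X -> {ptws (set nat) -> set_type (`[0, 1] : set R)},
    continuous f /\ range f = setT.
Proof.
have [h [hcont h01 hindep]] := independent_functions R hideal hpow hc
  hcompact hhausdorff hseparable hcard.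
have /choice[f fP] : forall i, exists f : X -> R, continuous f /\
    forall x N, binary_sum ((h i)^~ x) N <= f x <= binary_sum ((h i)^~ x) N + 2^-1 ^+ N.
  by move=> i; exact: binary_series.
have f01 (i : set nat) (x : X) : f i x \in (`[0, 1]%classic : set R).
  have [_ /(_ x 0%N)] := fP i; rewrite /binary_sum big_nil add0r expr0.
  by rewrite inE /= in_itv.
exists (fun x i => SigSub (f01 i x)); split.
  by apply: continuous_ptws => i; have [] := fP i.
apply/seteqP; split => // y _.
have /choice[d dP] : forall i, exists d : nat -> bool, forall N,
    binary_sum (fun k => (d k)%:R) N <= set_val (y i) <=
    binary_sum (fun k => (d k)%:R) N + 2^-1 ^+ N.
  move=> i; apply: binary_digits; have := set_valP (y i).
  by rewrite /= in_itv.
have [z zP] := hindep d.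
exists z => //; apply: functional_extensionality_dep => i; apply: val_inj => /=.
have digits N : binary_sum ((h i)^~ z) N = binary_sum (fun k => (d i k)%:R) N.
  by rewrite /binary_sum; apply: eq_bigr => k _; rewrite zP.
have fz N : binary_sum (fun k => (d i k)%:R) N <= f i z <=
    binary_sum (fun k => (d i k)%:R) N + 2^-1 ^+ N.
  by rewrite -digits; have [_] := fP i.
apply/eqP; rewrite eq_le; apply/andP; split; first exact: binary_sum_le fz (dP i).
exact: binary_sum_le (dP i) fz.
Qed.
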